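(* For odd $n>1$ let $B_n$ be the barbell graph on $n$ vertices and $v_{\rm c}$ its center. Then, as $n\to\infty$ over odd integers, $C_{v_{\rm c}}(B_n)=\Theta(n^2)$, but there is a choice of $k=k(n)=\Theta(\log n)$ for which $C_{v_{\rm c}}^{k}(B_n)=O(n)$.
   Context: For an odd integer $n>1$, the barbell graph $B_n$ consists of two disjoint cliques of size $(n-1)/2$ connected by a path of length $2$: one further vertex, the center $v_{\rm c}$, is joined by one edge to one vertex of the first clique and by one edge to one vertex of the second clique. A simple random walk on a finite graph moves at each step from the current vertex to a uniformly random neighbor. For a finite connected graph $G$, a vertex $i$ and an integer $k\ge 1$, let $\tau_i^k$ be the first time by which every vertex of $G$ has been visited by at least one of $k$ independent simple random walks, all started at $i$ at time $0$ and moving simultaneously (the vertex occupied at time $0$ counts as visited). Put $C_i^k(G)=E[\tau_i^k]$ and $C_i(G)=C_i^1(G)$. *)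

(* Defs.v *)
From HB Require Import structures.
From mathcomp Require Export all_boot all_order all_algebra.
From mathcomp Require Export all_classical all_reals all_analysis.

Set Implicit Arguments.
Unset Strict Implicit.
Unset Printing Implicit Defensive.

Import Order.TTheory GRing.Theory Num.Theory.
Import numFieldNormedType.Exports.

Local Open Scope classical_set_scope.
Local Open Scope ring_scope.

(** A finite simple graph is a symmetric irreflexive [e : rel V] on a finite
    type [V]. *)

Section RandomWalk.
Context (R : realType) (V : finType) (e : rel V).
Context (d : measure_display) (T : measurableType d) (P : probability T R).

Definition degree (x : V) : nat := #|[pred y | e x y]|.

Definition step_prob (x y : V) : R :=
  if e x y then (degree x)%:R^-1 else 0.

(** [X] follows the trajectory [p] at times 0, ..., t (the values of [p]
    after time [t] are irrelevant). *)
Definition follows (X : nat -> T -> V) (p : nat -> V) (t : nat) : set T :=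
  [set w | forall s, (s <= t)%N -> X s w = p s].

(** The third condition is
    P(X_{t+1} = y | X_0 = p_0, ..., X_t = p_t) = step_prob p_t y,
    multiplied out so as to be meaningful for trajectories of probability 0. *)
Definition simple_random_walk (i : V) (X : nat -> T -> V) : Prop :=
  [/\ forall t v, measurable [set w | X t w = v],
      P [set w | X 0%N w = i] = 1%E &
      forall (p : nat -> V) (t : nat) (y : V),
        P (follows X p t `&` [set w | X t.+1 w = y]) =
        (P (follows X p t) * (step_prob (p t) y)%:E)%E].

Definition process_sigma_algebra (X : nat -> T -> V) : set (set T) :=
  <<s [set A | exists t v, A = [set w | X t w = v]] >>.

(** Mutual independence of the processes [X j]; product rules over
    subfamilies are obtained by taking [A j = setT] for the other [j]. *)
Definition independent_processes (k : nat) (X : 'I_k -> nat -> T -> V) : Prop :=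
  forall A : 'I_k -> set T,
    (forall j, process_sigma_algebra (X j) (A j)) ->
    P [set w | forall j, A j w] = (\prod_(j < k) P (A j))%E.

Definition independent_walks (i : V) (k : nat)
    (X : 'I_k -> nat -> T -> V) : Prop :=
  (forall j, simple_random_walk i (X j)) /\ independent_processes X.

Definition covered (k : nat) (X : 'I_k -> nat -> T -> V) (t : nat) (w : T) :
    Prop :=
  forall v, exists j s, (s <= t)%N /\ X j s w = v.

(** The first time at which all vertices are covered; [+oo] if there is none. *)
Definition cover_time (k : nat) (X : 'I_k -> nat -> T -> V) (w : T) : \bar R :=
  ereal_inf [set t%:R%:E | t in [set t : nat | covered X t w]].

End RandomWalk.

(** [expected_cover_time e i k c] means that [c] is C_i^k(G), G being the graph
    on [V] with edge relation [e]: [c] is the expectation of the cover time of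
    [k] independent simple random walks started at [i], realized on some
    probability space. As the law of the walks is determined by
    [independent_walks], [c] does not depend on the realization. *)
Definition expected_cover_time (R : realType) (V : finType) (e : rel V)
    (i : V) (k : nat) (c : \bar R) : Prop :=
  exists (d : measure_display) (T : measurableType d) (P : probability T R)
         (X : 'I_k -> nat -> T -> V),
    independent_walks e P i X /\ c = (\int[P]_w cover_time R X w)%E.

(** The barbell graph, meaningful for odd [n > 1], for which
    [n./2 = (n - 1) / 2]: [None] is the center and [Some (b, j)] is the vertex
    number [j] of the clique [b]. The center is joined to the vertex number 0
    of each clique. *)
Definition barbell_vertex (n : nat) : finType := option (bool * 'I_n./2)%type.

Definition barbell (n : nat) : rel (barbell_vertex n) := fun x y =>
  match x, y with
  | None, None => false
  | None, Some (_, j) => val j == 0%N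
  | Some (_, j), None => val j == 0%N
  | Some (b, j), Some (b', j') => (b == b') && (j != j')
  end.

Definition barbell_center (n : nat) : barbell_vertex n := None.

Lemma card_barbell (n : nat) : odd n -> #|barbell_vertex n| = n.
Proof.
move=> n_odd; rewrite card_option card_prod card_bool card_ord mul2n.
by rewrite -[RHS]odd_double_half n_odd.
Qed.

Lemma barbell_sym (n : nat) : symmetric (@barbell n).
Proof.
move=> [[b j]|] [[b' j']|] //=.
by rewrite eq_sym [j == _]eq_sym.
Qed.

Lemma barbell_irrefl (n : nat) : irreflexive (@barbell n).
Proof. by move=> [[b j]|] //=; rewrite !eqxx. Qed.

(* Main.v *)
Require Import Defs.
From mathcomp Require Import ring lra.

Set Implicit Arguments.
Unset Strict Implicit.
Unset Printing Implicit Defensive.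

Import Order.TTheory GRing.Theory Num.Theory.
Import numFieldNormedType.Exports.

Local Open Scope classical_set_scope.
Local Open Scope ring_scope.

(** The expected cover time is the sum over [t] of the probabilities of not being
    covered at time [t], and these are obtained by iterating the transition
    operator of the chain (position, set of unvisited vertices). Put [m = (n-1)/2].

    For one walk, a walk that has entered a clique returns to the center with
    probability of order [t / m^2] within [t] steps, so that the other clique stays
    unvisited for order [m^2] steps with probability at least [1/2]; a potential
    function of size [O(m^2)] that decreases by one per step in expectation gives
    the matching upper bound.

    For [k] walks, let [q_v(t)] be the probability that one walk misses [v] up to
    time [t]. A walk enters the clique of [v] at its first step with probability
    [1/2] and then finds [v] within [m] steps with a constant probability, hence
    [q_v(t) <= 7/8] for [t > m]; and the sum of [q_v(t)] over [t] is [O(m^2)] by the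
    one-walk bound. Since the [k] walks all miss [v] with probability [q_v(t)^k], the
    expected cover time is at most
    [m + 1 + sum_v (7/8)^(k-1) * O(m^2) = O(n)] once [(7/8)^(k-1) <= n^-2]. *)

(** * Events of finite-valued random variables *)

Section FiniteValued.
Context (R : realType) (d : measure_display) (T : measurableType d).
Context (V : finType) (f : T -> V).
Hypothesis f_meas : forall v, measurable [set w | f w = v].

Lemma measurable_finite_pred (A : pred V) : measurable [set w | A (f w)].
Proof.
have -> : [set w | A (f w)] = \bigcup_(v in [set v | A v]) [set w | f w = v].
  apply/seteqP; split=> w /=; first by move=> Aw; exists (f w).
  by case=> v /= Av ->.
by apply: fin_bigcup_measurable => //; exact: finite_finset.
Qed.

Lemma probability_finite_partition (mu : probability T R) (E : set T) :
  measurable E -> mu E = (\sum_v mu (E `&` [set w | f w = v]))%E.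
Proof.
move=> mE.
have {1}-> : E = \bigcup_(v in [set` index_enum V]) (E `&` [set w | f w = v]).
  apply/seteqP; split=> w /=; last by case=> v _ [].
  by move=> Ew; exists (f w) => //=; exact: mem_index_enum.
rewrite [RHS]fsbig_seq; last exact: index_enum_uniq.
apply: measure_fin_bigcup; first exact: finite_seq.
- apply/trivIsetP => u v _ _ uv; apply/seteqP; split=> w //= [[_ fu] [_ fv]].
  by rewrite -fu -fv eqxx in uv.
- by move=> v _; exact: measurableI.
Qed.

End FiniteValued.

(** * The expected cover time as a sum of tail probabilities *)

Section CoverTime.
Context (R : realType) (V : finType).
Context (d : measure_display) (T : measurableType d) (P : probability T R).
Context (k : nat) (X : 'I_k -> nat -> T -> V).

Definition uncovered (t : nat) : set T := [set w | ~ covered X t w].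

Lemma covered_mono (s t : nat) (w : T) :
  (s <= t)%N -> covered X s w -> covered X t w.
Proof.
move=> st cov v; have [j [r [rs <-]]] := cov v.
by exists j, r; split=> //; exact: leq_trans rs st.
Qed.

(** Being uncovered is decreasing in time, so the indicators are ones up to the first covering time
    and zeros from it on. If no such time exists, the infimum of the empty set is [+oo] and every
    term of the series is 1. *)
Lemma cover_time_series (w : T) :
  cover_time R X w = (\sum_(0 <= t <oo) (\1_(uncovered t) w)%:E)%E.
Proof.
have nneg t : (0%N <= t)%N -> true -> (0 <= (\1_(uncovered t) w : R)%:E)%E.
  by move=> _ _; rewrite lee_fin.
have [|nocov] := pselect (exists t, covered X t w).
  move=> /[dup] ex_cov [t1 cov1].
  have exP : exists t, `[< covered X t w >] by exists t1; apply/asboolP.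
  case: (ex_minnP exP) => t0 /asboolP cov0 min0.
  have -> : cover_time R X w = t0%:R%:E.
    apply/le_anti/andP; split.
      by apply: ereal_inf_lbound; exists t0.
    apply/ereal_infP => y [t /= cov_t <-]; rewrite lee_fin ler_nat.
    by apply: min0; apply/asboolP.
  rewrite (nneseries_split 0 t0); last by move=> t _; exact: nneg.
  rewrite add0n eseries0 ?adde0; last first.
    move=> t t0t _; rewrite indicE memNset //=; apply; exact: covered_mono cov0.
  rewrite big_mkord (eq_bigr (fun=> 1%:E)).
    by rewrite sumEFin sumr_const card_ord.
  move=> [t /= tt0] _; rewrite indicE mem_set //= => cov_t.
  have := min0 t; rewrite leqNgt tt0 /=.
  by move/asboolP: cov_t => -> /(_ isT).
have -> : cover_time R X w = +oo%E.
  rewrite /cover_time (_ : [set _ | _ in _] = set0) ?ereal_inf0 //.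
  apply/seteqP; split=> y //= [t cov_t _]; apply: nocov; by exists t.
apply/esym/eqyP => A _.
have /= := nneseries_lim_ge (Num.truncn `|A|).+1 nneg; apply: le_trans.
rewrite big_mkord (eq_bigr (fun=> 1%:E)); last first.
  by move=> t _; rewrite indicE mem_set //= => cov_t; apply: nocov; exists t.
rewrite sumEFin sumr_const card_ord lee_fin.
apply: (le_trans (ler_norm _)); apply: ltW.
by apply: truncnS_gt.
Qed.

Hypothesis X_meas : forall j t v, measurable [set w | X j t w = v].

Lemma measurable_uncovered (t : nat) : measurable (uncovered t).
Proof.
have -> : uncovered t = \bigcup_(v in [set: V])
   ~` \bigcup_(j in [set: 'I_k]) \bigcup_(s in `I_t.+1) [set w | X j s w = v].
  apply/seteqP; split=> w /=.
    move=> /existsNP [v nv]; exists v => // -[j _ [s st /= Xs]].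
    by apply: nv; exists j, s; split.
  case=> v _ nv cov; apply: nv.
  by have [j [s [st Xs]]] := cov v; exists j => //; exists s.
apply: fin_bigcup_measurable; first exact: finite_finset.
move=> v _; apply: measurableC.
apply: fin_bigcup_measurable; first exact: finite_finset.
by move=> j _; apply: fin_bigcup_measurable.
Qed.

Lemma integral_cover_time :
  (\int[P]_w cover_time R X w)%E = (\sum_(0 <= t <oo) P (uncovered t))%E.
Proof.
under eq_integral do rewrite cover_time_series.
rewrite integral_nneseries //.
- apply: eq_eseriesr => t _; rewrite integral_indic ?setIT //.
  exact: measurable_uncovered.
- move=> t; apply/measurable_realfun.measurable_EFinP.
  apply: measurable_realfun.measurable_indic.
  exact: measurable_uncovered.
Qed.

End CoverTime.

(** * The law of the pair of position and unvisited set *)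

Section Walk.
Context (R : realType) (V : finType) (e : rel V).

(** [gen] is the transition operator of the Markov chain formed by the position
    of the walk and the set of vertices not yet visited. *)
Definition gen (F : V -> {set V} -> R) (x : V) (S : {set V}) : R :=
  \sum_y step_prob R e x y * F y (S :\ y)%SET.

Context (d : measure_display) (T : measurableType d) (P : probability T R).
Implicit Type X : nat -> T -> V.

Definition unvisited X (t : nat) (w : T) : {set V} :=
  finset (fun v => [forall s : 'I_t.+1, X s w != v]).

Definition state X t w : V * {set V} := (X t w, unvisited X t w).

Definition history X (t : nat) (w : T) : {ffun 'I_t.+1 -> V} :=
  [ffun s : 'I_t.+1 => X s w].

(** The state factors through the finite-valued history, which is the object that the definition of
    the walk conditions on. *)
Definition state_of (t : nat) (p : {ffun 'I_t.+1 -> V}) : V * {set V} :=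
  (p ord_max, finset (fun v => [forall s, p s != v])).

Lemma stateE X t w : state X t w = state_of (history X t w).
Proof.
rewrite /state /state_of ffunE; congr pair.
by apply/setP => v; rewrite !inE; apply: eq_forallb => s; rewrite ffunE.
Qed.

Lemma unvisited0 X w : unvisited X 0 w = (~: [set X 0%N w])%SET.
Proof.
apply/setP => v; rewrite !inE eq_sym; apply/forallP/idP => [/(_ ord0)//|H s].
by rewrite ord1.
Qed.

Lemma unvisitedS X t w :
  unvisited X t.+1 w = (unvisited X t w :\ X t.+1 w)%SET.
Proof.
apply/setP => v; rewrite !inE eq_sym.
apply/forallP/andP => [H|[H1 /forallP H2] s].
  split; first exact: (H ord_max).
  by apply/forallP => s; apply: (H (widen_ord (leqnSn _) s)).
have [->//|ne] := eqVneq (s : nat) t.+1.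
have lt_s : (s < t.+1)%N by rewrite ltn_neqAle ne -ltnS ltn_ord.
exact: (H2 (Ordinal lt_s)).
Qed.

Lemma history_follows X t (p : {ffun 'I_t.+1 -> V}) :
  [set w | history X t w = p] = follows X (fun s => p (inord s)) t.
Proof.
apply/seteqP; split=> w /=.
  by move=> <- s st; rewrite ffunE inordK.
move=> H; apply/ffunP => s; rewrite ffunE.
by rewrite H ?inord_val // -ltnS.
Qed.

Section Measurability.
Variable X : nat -> T -> V.
Hypothesis X_meas : forall t v, measurable [set w | X t w = v].

Lemma measurable_history t (p : {ffun 'I_t.+1 -> V}) :
  measurable [set w | history X t w = p].
Proof.
rewrite history_follows.
rewrite (_ : follows _ _ _ = \bigcap_(s in `I_t.+1) [set w | X s w = p (inord s)]).
  exact: fin_bigcap_measurable.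
by apply/seteqP; split=> w H s; apply: H.
Qed.

Lemma measurable_state_pred t (A : pred (V * {set V})) :
  measurable [set w | A (state X t w)].
Proof.
rewrite (_ : mkset _ = [set w | (A \o @state_of t) (history X t w)]).
  exact: measurable_finite_pred (@measurable_history t) _.
by apply/seteqP; split=> w /=; rewrite stateE.
Qed.

Lemma measurable_state t z : measurable [set w | state X t w = z].
Proof.
rewrite (_ : mkset _ = [set w | pred1 z (state X t w)]).
  exact: measurable_state_pred.
by apply/seteqP; split=> w /= /eqP.
Qed.

End Measurability.

Section Law.
Variables (i : V) (X : nat -> T -> V).
Hypothesis walk : simple_random_walk e P i X.

Let X_meas t v : measurable [set w | X t w = v].
Proof. by case: walk. Qed.

(** Split over the histories up to time [t]. One that does not produce [z] contributes zero to both
    sides; one that does ends at [z.1], so the defining property of the walk applies with the same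
    factor for all of them. *)
Lemma state_markov t z y :
  P ([set w | state X t w = z] `&` [set w | X t.+1 w = y]) =
  (P [set w | state X t w = z] * (step_prob R e z.1 y)%:E)%E.
Proof.
have mhist := measurable_history X_meas (t := t).
have mz := measurable_state X_meas t z.
rewrite (probability_finite_partition mhist) //; last exact: measurableI.
rewrite [in RHS](probability_finite_partition mhist) // ge0_sume_distrl //.
apply: eq_bigr => p _.
have [pz|pz] := eqVneq (state_of p) z; last first.
  have empty (A : set T) : A `<=` [set w | state X t w = z] ->
      P (A `&` [set w | history X t w = p]) = 0%E.
    move=> Az; rewrite -[RHS](measure0 P); congr (P _).
    apply/seteqP; split=> w //= [/Az/= zw pw].
    by move: pz; rewrite -zw -pw stateE eqxx.
  by rewrite !empty ?mul0e // => w [].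
have -> : [set w | state X t w = z] `&` [set w | X t.+1 w = y] `&`
    [set w | history X t w = p] =
    [set w | history X t w = p] `&` [set w | X t.+1 w = y].
  apply/seteqP; split=> w /= [].
    by case=> _ ? ?.
  by move=> pw; rewrite stateE pw.
have -> : [set w | state X t w = z] `&` [set w | history X t w = p] =
    [set w | history X t w = p].
  apply/seteqP; split=> w /=; first by case.
  by move=> pw; rewrite stateE pw.
rewrite history_follows; case: walk => _ _ ->; congr (_ * _%:E)%E.
by rewrite -pz /state_of /= (_ : inord t = ord_max) //;
  apply/val_inj; rewrite /= inordK.
Qed.

Definition state_law t z : R := fine (P [set w | state X t w = z]).

Lemma state_lawE t z : P [set w | state X t w = z] = (state_law t z)%:E.
Proof.
rewrite /state_law fineK //; apply: fin_num_measure; exact: measurable_state.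
Qed.

Lemma state_lawS t y S :
  state_law t.+1 (y, S) =
  \sum_z (if (z.2 :\ y)%SET == S then state_law t z * step_prob R e z.1 y else 0).
Proof.
apply: EFin_inj; rewrite -state_lawE -sumEFin.
rewrite (probability_finite_partition (measurable_state X_meas t)); last first.
  exact: measurable_state.
apply: eq_bigr => z _; case: ifPn => [/eqP zS|zS].
  rewrite EFinM -state_lawE -state_markov; congr (P _).
  apply/seteqP; split=> w /=.
    by case=> -[Xy _] zw; split=> //; rewrite -zw.
  case=> zw Xy; split=> //; rewrite /state unvisitedS Xy -zS -zw.
  by [].
rewrite -[RHS](measure0 P); congr (P _).
apply/seteqP; split=> w //= [[Xy uS] zw].
by move: zS; rewrite -uS unvisitedS Xy -zw eqxx.
Qed.

(** Duality: advancing the law by one step amounts to applying [gen] to the test function. *)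
Lemma sum_state_lawS t (F : V -> {set V} -> R) :
  \sum_z state_law t.+1 z * F z.1 z.2 = \sum_z state_law t z * gen F z.1 z.2.
Proof.
under [RHS]eq_bigr do rewrite /gen mulr_sumr.
rewrite [RHS]exchange_big /=.
rewrite [LHS](eq_bigr (fun z => state_law t.+1 (z.1, z.2) * F z.1 z.2)); last by case.
rewrite -(pair_bigA _ (fun y S => state_law t.+1 (y, S) * F y S)) /=.
apply: eq_bigr => y _.
under eq_bigr do rewrite state_lawS mulr_suml.
rewrite exchange_big; apply: eq_bigr => z _ /=.
rewrite (bigD1 (z.2 :\ y)%SET) //= eqxx big1 ?addr0 ?mulrA // => S /negbTE.
by rewrite eq_sym => ->; rewrite mul0r.
Qed.

Lemma state_law0 z : state_law 0 z = (z == (i, (~: [set i])%SET))%:R.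
Proof.
have mz := measurable_state X_meas 0 z.
have Pi : P [set w | X 0%N w = i] = 1%E by case: walk.
apply: EFin_inj; rewrite -state_lawE.
have [->|zi] := eqVneq z.
  rewrite -Pi; congr (P _); apply/seteqP; split=> w /=.
    by case.
  by rewrite /state unvisited0 => ->.
apply/eqP; rewrite eq_le measure_ge0 andbT.
have Pni : P (~` [set w | X 0%N w = i]) = 0%E.
  by rewrite probability_setC ?Pi ?subee //; exact: X_meas.
apply: (@le_trans _ _ (P (~` [set w | X 0%N w = i]))); last by rewrite Pni.
apply: le_measure; rewrite ?inE //; first exact/measurableC/X_meas.
move=> w /= zw Xi; move: zi.
by rewrite -zw /state unvisited0 Xi eqxx.
Qed.

Lemma sum_state_law t (F : V -> {set V} -> R) :
  \sum_z state_law t z * F z.1 z.2 = iter t gen F i (~: [set i])%SET.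
Proof.
elim: t F => [|t IH] F; last by rewrite sum_state_lawS IH iterSr.
rewrite (bigD1 (i, (~: [set i])%SET)) //= state_law0 eqxx mul1r big1 ?addr0 //.
by move=> z /negbTE zi; rewrite state_law0 zi mul0r.
Qed.

Lemma prob_state t (A : pred (V * {set V})) :
  P [set w | A (state X t w)] =
  (iter t gen (fun x S => (A (x, S))%:R) i (~: [set i])%SET)%:E.
Proof.
rewrite -sum_state_law -sumEFin.
rewrite (probability_finite_partition (measurable_state X_meas t)); last first.
  exact: measurable_state_pred.
apply: eq_bigr => z _; rewrite -surjective_pairing EFinM -state_lawE.
have [Az|nAz] := boolP (A z).
  rewrite mule1; congr (P _); apply/seteqP; split=> w /=; first by case.
  by move=> zw; rewrite zw.
rewrite mule0 -[RHS](measure0 P); congr (P _).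
by apply/seteqP; split=> w //= [Aw zw]; move: nAz; rewrite -zw Aw.
Qed.

End Law.

Lemma uncovered1E (X : 'I_1 -> nat -> T -> V) t :
  uncovered X t = [set w | unvisited (X ord0) t w != finset.set0].
Proof.
apply/seteqP; split=> w /=.
  move=> ncov; apply/set0Pn; have /existsNP[v nv] := ncov.
  exists v; rewrite inE; apply/forallP => s; apply/eqP => Xv; apply: nv.
  by exists ord0, s; split=> //; rewrite -ltnS.
move=> /set0Pn[v]; rewrite inE => /forallP nv cov.
have [j [s [st Xv]]] := cov v.
by move: (nv (Ordinal (st : (s < t.+1)%N))); rewrite /= -Xv (ord1 j) eqxx.
Qed.

(** Independence is postulated for the generated sigma-algebras; missing [v] belongs to one as the
    complement of a countable union of generators, padded with empty sets after time [t]. *)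
Lemma unvisited_process_sigma_algebra X t v :
  process_sigma_algebra X [set w | v \in unvisited X t w].
Proof.
rewrite /process_sigma_algebra.
set G := (G in <<s G >>).
have [alg0 algC algU] := smallest_sigma_algebra [set: T] G.
rewrite (_ : mkset _ = [set: T] `\`
  \bigcup_s (if (s <= t)%N then [set w | X s w = v] else set0)).
  apply: (algC); apply: (algU) => s; case: ifP => _; last exact: alg0.
  by apply: sub_sigma_algebra; exists s, v.
apply/seteqP; split=> w /=; rewrite inE.
  move=> /forallP nv; split=> // -[s _]; case: ifP => //= st /eqP Xv.
  by move: (nv (Ordinal (st : (s < t.+1)%N))); rewrite /= Xv.
case=> _ nv; apply/forallP => s; apply/eqP => Xv; apply: nv.
by exists s => //; rewrite -ltnS ltn_ord.
Qed.

(** If the graph is uncovered, all walks miss a common vertex; by independence and equality of laws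
    this has the [k]-th power of the one-walk probability. *)
Lemma uncovered_union_bound (i : V) (k : nat) (X : 'I_k -> nat -> T -> V) t :
  independent_walks e P i X ->
  (P (uncovered X t) <=
   (\sum_v (iter t gen (fun _ S => (v \in S)%:R) i (~: [set i])%SET) ^+ k)%:E)%E.
Proof.
move=> [walks indep].
have X_meas j s v : measurable [set w | X j s w = v] by case: (walks j).
have mU j v : measurable [set w | v \in unvisited (X j) t w].
  exact: (measurable_state_pred (X_meas j) t (fun z => v \in z.2)).
have PU v : P [set w | forall j, v \in unvisited (X j) t w] =
    ((iter t gen (fun _ S => (v \in S)%:R) i (~: [set i])%SET) ^+ k)%:E.
  have := indep (fun j => [set w | v \in unvisited (X j) t w]) (fun j =>
     unvisited_process_sigma_algebra (X := X j) t v).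
  rewrite /= => ->.
  under eq_bigr do rewrite (prob_state (walks _) t (fun z => v \in z.2)).
  by rewrite prodEFin prodr_const card_ord.
rewrite -sumEFin; under eq_bigr do rewrite -PU.
rewrite fsbig_seq; last exact: index_enum_uniq.
apply: content_sub_fsum; first exact: finite_seq.
- move=> v _; rewrite (_ : mkset _ =
      \bigcap_(j in [set: 'I_k]) [set w | v \in unvisited (X j) t w]).
    by apply: fin_bigcap_measurable => //; exact: finite_finset.
  by apply/seteqP; split=> w /= H j; [move=> _|]; exact: H.
- exact: measurable_uncovered.
move=> w /existsNP[v nv]; exists v; first exact: mem_index_enum.
move=> j; rewrite inE; apply/forallP => s; apply/eqP => Xv; apply: nv.
by exists j, s; split=> //; rewrite -ltnS.
Qed.

End Walk.

(** * Comparison principles for the transition operator *)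

Section Generator.
Context (R : realType) (V : finType) (e : rel V).
Implicit Types F G : V -> {set V} -> R.

Lemma genE F x S :
  gen e F x S = (degree e x)%:R^-1 * \sum_(y | e x y) F y (S :\ y)%SET.
Proof.
rewrite /gen [in RHS]big_mkcond mulr_sumr; apply: eq_bigr => y _.
by rewrite /step_prob; case: ifP => _; rewrite ?mul0r ?mulr0.
Qed.

Lemma gen_le F G x S :
  (forall y, e x y -> F y (S :\ y)%SET <= G y (S :\ y)%SET) ->
  gen e F x S <= gen e G x S.
Proof.
move=> FG; rewrite !genE ler_wpM2l ?invr_ge0 ?ler0n //.
exact: ler_sum.
Qed.

Lemma gen_sum (I : Type) (r : seq I) (F : I -> V -> {set V} -> R) x S :
  gen e (fun x S => \sum_(i <- r) F i x S) x S = \sum_(i <- r) gen e (F i) x S.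
Proof.
rewrite /gen exchange_big /=; apply: eq_bigr => y _.
by rewrite mulr_sumr.
Qed.

Lemma gen_ge0 F x S :
  (forall y S', 0 <= F y S') -> 0 <= gen e F x S.
Proof.
by move=> F0; rewrite genE mulr_ge0 ?invr_ge0 ?ler0n ?sumr_ge0.
Qed.

Lemma iter_gen_ge0 t F x S :
  (forall y S', 0 <= F y S') -> 0 <= iter t (gen e) F x S.
Proof. by move=> F0; elim: t x S => //= t IH x S; exact: gen_ge0. Qed.

Lemma gen_le1 F x S :
  (forall y S', F y S' <= 1) -> gen e F x S <= 1.
Proof.
move=> F1; rewrite genE.
apply: (@le_trans _ _ ((degree e x)%:R^-1 * (degree e x)%:R)).
  rewrite ler_wpM2l ?invr_ge0 ?ler0n // /degree -sum1_card natr_sum.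
  exact: ler_sum.
have [->|d0] := eqVneq (degree e x) 0%N; first by rewrite mulr0 ler01.
by rewrite mulVf // pnatr_eq0.
Qed.

Variable inv : V -> {set V} -> Prop.
Hypothesis inv_step : forall x S y, inv x S -> inv y (S :\ y)%SET.

(** Lyapunov argument: [F] pays for the current cost [f] and for its own expected value after one
    step. The invariant restricts the drift condition to the states that can occur. *)
Lemma sum_iter_gen_le f F :
  (forall x S, 0 <= F x S) ->
  (forall x S, inv x S -> f x S + gen e F x S <= F x S) ->
  forall N x S, inv x S -> \sum_(0 <= t < N) iter t (gen e) f x S <= F x S.
Proof.
move=> F0 fF; elim=> [|N IH] x S xS; first by rewrite big_nil.
apply: le_trans (fF _ _ xS); rewrite big_nat_recl //= lerD2l -gen_sum.
by apply: gen_le => y _; apply: IH; exact: inv_step xS.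
Qed.

(** Here [G] is a supersolution indexed by the number of steps still to be made; monotonicity of
    [gen] propagates the comparison. Reversing the inequalities gives the version for lower bounds
    that follows. *)
Lemma iter_gen_le f (G : nat -> V -> {set V} -> R) :
  (forall x S, inv x S -> f x S <= G 0%N x S) ->
  (forall t x S, inv x S -> gen e (G t) x S <= G t.+1 x S) ->
  forall t x S, inv x S -> iter t (gen e) f x S <= G t x S.
Proof.
move=> fG GG; elim=> [|t IH] x S xS /=; first exact: fG.
by apply: le_trans (GG _ _ _ xS); apply: gen_le => y _; apply/IH/inv_step/xS.
Qed.

Lemma iter_gen_ge f (G : nat -> V -> {set V} -> R) :
  (forall x S, inv x S -> G 0%N x S <= f x S) ->
  (forall t x S, inv x S -> G t.+1 x S <= gen e (G t) x S) ->
  forall t x S, inv x S -> G t x S <= iter t (gen e) f x S.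
Proof.
move=> fG GG; elim=> [|t IH] x S xS /=; first exact: fG.
by apply: le_trans (GG _ _ _ xS) _; apply: gen_le => y _; apply/IH/inv_step/xS.
Qed.

End Generator.

(** * Transitions on the barbell graph *)

Section Barbell.
Context (R : realType) (n : nat).
Hypothesis m_ge8 : (8 <= n./2)%N.
Notation e := (@barbell n).
Notation m := (n./2).
Notation M := ((n./2)%:R : R).
Notation Vtx := (barbell_vertex n).

Let m_gt0 : (0 < m)%N. Proof. exact: leq_trans m_ge8. Qed.
Let M_ge8 : 8 <= M. Proof. by rewrite (ler_nat _ 8). Qed.

Definition gate : 'I_m := Ordinal m_gt0.

Lemma gateE (j : 'I_m) : (val j == 0%N) = (j == gate).
Proof. by []. Qed.

Lemma sum_barbell (f : Vtx -> R) :
  \sum_y f y = f None + \sum_b \sum_j f (Some (b, j)).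
Proof.
rewrite (bigD1 None) //= (reindex_omap Some id) /=; last by case.
rewrite pair_bigA /=; congr (_ + _); apply: eq_big => [p|[b j] _] //.
by rewrite eqxx.
Qed.

Lemma sum_nbr_center (f : Vtx -> R) :
  \sum_(y | e None y) f y = f (Some (false, gate)) + f (Some (true, gate)).
Proof.
rewrite big_mkcond sum_barbell /= add0r big_bool /= addrC.
by congr (_ + _); rewrite -big_mkcond /= (eq_bigl _ _ gateE) big_pred1_eq.
Qed.

Lemma sum_nbr_clique (b : bool) (j : 'I_m) (f : Vtx -> R) :
  \sum_(y | e (Some (b, j)) y) f y =
  (if j == gate then f None else 0) + \sum_(j' | j' != j) f (Some (b, j')).
Proof.
rewrite big_mkcond sum_barbell /= gateE; congr (_ + _).
rewrite big_bool /=.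
have nb k : \sum_j' (if k != j' then f (Some (b, j')) else 0) =
    \sum_(j' | j' != k) f (Some (b, j')).
  by rewrite -big_mkcond; apply: eq_bigl => j'; rewrite eq_sym.
case: b nb => nb /=; by rewrite nb big1_eq ?addr0 ?add0r.
Qed.

Lemma sum_neq (j : 'I_m) (f : 'I_m -> R) :
  \sum_(j' | j' != j) f j' = \sum_j' f j' - f j.
Proof. by rewrite [in RHS](bigD1 j) //= addrAC subrr add0r. Qed.

Lemma sum_neq_const (j : 'I_m) (c : R) : \sum_(j' | j' != j) c = (M - 1) * c.
Proof.
by rewrite (sum_neq j (fun=> c)) sumr_const card_ord -[c *+ _]mulr_natl mulrBl mul1r.
Qed.

(** The correction for the gate disappears when [j] is the gate itself, which is then left out of
    the sum. *)
Lemma sum_neq_gate (j : 'I_m) (a c : R) :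
  \sum_(j' | j' != j) (if j' == gate then a else c) =
  (M - 1) * c + (j != gate)%:R * (a - c).
Proof.
have [->|jg] := eqVneq j gate.
  rewrite mul0r addr0 -(sum_neq_const gate).
  by apply: eq_bigr => k /negbTE ->.
rewrite -(sum_neq_const j) mul1r (bigD1 gate) 1?eq_sym //=.
rewrite [in RHS](bigD1 gate) 1?eq_sym //=.
rewrite [RHS]addrC addrA subrK; congr (_ + _).
by apply: eq_bigr => k /andP[_ /negbTE ->].
Qed.

Lemma degree_center : (degree e None)%:R = 2 :> R.
Proof.
rewrite /degree -sum1_card natr_sum; have := sum_nbr_center (fun=> 1).
by rewrite /= => ->; rewrite -mulr2n.
Qed.

Lemma degree_clique b j :
  (degree e (Some (b, j)))%:R = (j == gate)%:R + (M - 1) :> R.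
Proof.
rewrite /degree -sum1_card natr_sum; have := sum_nbr_clique b j (fun=> 1).
rewrite /= => ->; rewrite sum_neq sumr_const card_ord.
by case: (j == gate).
Qed.

Lemma gen_center F S :
  gen e F None S = (F (Some (false, gate)) (S :\ Some (false, gate))%SET +
    F (Some (true, gate)) (S :\ Some (true, gate))%SET) / 2 :> R.
Proof. by rewrite genE degree_center sum_nbr_center mulrC. Qed.

Lemma gen_clique F b j S : gen e F (Some (b, j)) S =
  ((j == gate)%:R + (M - 1))^-1 *
  ((j == gate)%:R * F None (S :\ None)%SET +
   \sum_(j' | j' != j) F (Some (b, j')) (S :\ Some (b, j'))%SET) :> R.
Proof.
rewrite genE degree_clique sum_nbr_clique.
by case: (j == gate); rewrite ?mul1r ?mul0r.
Qed.

Lemma gen_clique_le F b j S B :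
  (j == gate)%:R * F None (S :\ None)%SET +
   \sum_(j' | j' != j) F (Some (b, j')) (S :\ Some (b, j'))%SET <=
   ((j == gate)%:R + (M - 1)) * B ->
  gen e F (Some (b, j)) S <= B :> R.
Proof.
move=> H; rewrite gen_clique mulrC ler_pdivrMr.
  by rewrite [X in _ <= X]mulrC.
by have := M_ge8; case: (j == gate); rewrite ?mulr1n ?mulr0n; lra.
Qed.

Lemma gen_clique_ge F b j S B :
   ((j == gate)%:R + (M - 1)) * B <=
  (j == gate)%:R * F None (S :\ None)%SET +
   \sum_(j' | j' != j) F (Some (b, j')) (S :\ Some (b, j'))%SET ->
  B <= gen e F (Some (b, j)) S :> R.
Proof.
move=> H; rewrite gen_clique mulrC ler_pdivlMr.
  by rewrite [X in X <= _]mulrC.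
by have := M_ge8; case: (j == gate); rewrite ?mulr1n ?mulr0n; lra.
Qed.

(** The invariant of states met by a walk from the center: the current vertex and the starting
    vertex are visited. *)
Definition reachable (x : Vtx) (S : {set Vtx}) : Prop := x \notin S /\ None \notin S.

Lemma reachable_step x S y : reachable x S -> reachable y (S :\ y)%SET.
Proof. by case=> _ nS; split; rewrite !inE ?eqxx // (negbTE nS) andbF. Qed.

Lemma reachable_start : reachable None (~: [set None])%SET.
Proof. by split; rewrite !inE. Qed.

(** * Upper bound for one walk by a potential function *)

Definition left_in (b : bool) (S : {set Vtx}) : nat :=
  \sum_(j < m) (Some (b, j) \in S).

(** The expected time to finish clique [b] is at most [position_cost] plus [3 M]
    per vertex left: inside [b] each step visits a new vertex with probability
    at least [1 / M], and coming back from the other clique costs order [M ^ 2].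
    The [2 M] at the gate of [b] pays for stepping to the center with
    probability [1 / M]. *)
Definition position_cost (b : bool) (x : Vtx) : R :=
  match x with
  | None => 2 * M ^+ 2
  | Some (b', j) =>
      if b' == b then (if j == gate then 2 * M else 0)
      else (if j == gate then 3 * M ^+ 2 - M + 1 else 3 * M ^+ 2)
  end.

Definition potential (b : bool) (x : Vtx) (S : {set Vtx}) : R :=
  if left_in b S == 0%N then 0
  else position_cost b x + 3 * M * (left_in b S)%:R.

Lemma position_cost_ge0 b x : 0 <= position_cost b x.
Proof.
case: x => [[b' j]|] /=; last by rewrite mulr_ge0 ?sqr_ge0.
by have M8 := M_ge8; case: ifP => _; case: ifP => _; nra.
Qed.

Lemma potential_ge0 b x S : 0 <= potential b x S.
Proof.
rewrite /potential; case: ifP => // _.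
by rewrite addr_ge0 ?position_cost_ge0 // !mulr_ge0.
Qed.

Lemma left_inD1 b S y : (left_in b (S :\ y) +
  (if y is Some (b', j) then (b' == b) && (y \in S) else false) =
  left_in b S)%N.
Proof.
rewrite /left_in; case: y => [[b' j]|]; last first.
  by rewrite addn0; apply: eq_bigr => j _; rewrite !inE.
have [->|bb] /= := eqVneq b' b; last first.
  rewrite addn0; apply: eq_bigr => j' _; rewrite !inE.
  rewrite (_ : _ == _ = false) //; apply: contraNF bb => /eqP[<- _].
  exact: eqxx.
rewrite (bigD1 j) //= [RHS](bigD1 j) //= !inE eqxx /= add0n addnC; congr addn.
apply: eq_bigr => j' jj'; rewrite !inE (_ : _ == _ = false) //.
by apply: contraNF jj' => /eqP[->].
Qed.

(** Equality can fail only when nothing is left in clique [b] and the potential is 0. The right side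
    is affine in the indicator of a new visit, so it can be summed over the neighbors. *)
Lemma potential_le b y S : potential b y (S :\ y) <=
  position_cost b y + 3 * M * ((left_in b S)%:R -
   (if y is Some (b', j) then (b' == b) && (y \in S) else false)%:R).
Proof.
rewrite -(left_inD1 b S y) natrD addrK /potential; case: ifP => // _.
by rewrite addr_ge0 ?position_cost_ge0 // !mulr_ge0.
Qed.

(** In the far clique [position_cost] drops by exactly one on average: away from the gate, one of
    the [M - 1] neighbors is the gate, cheaper by [M - 1]; at the gate, the center has probability
    [1 / M] and costs [M ^ 2] less than the other vertices. In clique [b] the gain of [3 M] per new
    vertex outweighs the cost of [2 M] for moving to the gate. *)
Lemma potential_drift b x S : reachable x S ->
  (left_in b S != 0%N)%:R + gen e (potential b) x S <= potential b x S.
Proof.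
move=> [xS _]; have M8 := M_ge8.
have [N0|N0] /= := eqVneq (left_in b S) 0%N.
  rewrite {2}/potential N0 eqxx add0r genE big1 ?mulr0 // => y _.
  move: N0; rewrite -(left_inD1 b S y) /potential => /eqP.
  by rewrite addn_eq0 => /andP[->].
rewrite -lerBrDl.
have leP y := potential_le b y S.
rewrite {2}/potential (negbTE N0).
have : 1 <= (left_in b S)%:R :> R by rewrite (ler_nat _ 1) lt0n.
have NE : (left_in b S)%:R = \sum_(j < m) (Some (b, j) \in S)%:R :> R.
  by rewrite /left_in natr_sum.
move: (left_in b S)%:R NE leP => N NE leP N1.
case: x xS => [[b' j]|] xS; last first.
  rewrite gen_center.
  have := lerD (leP (Some (false, gate))) (leP (Some (true, gate))) => /=.
  have i0 (a : bool) : 0 <= 3 * M * a%:R by rewrite !mulr_ge0.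
  have := i0 (Some (false, gate) \in S); have := i0 (Some (true, gate) \in S).
  by case: b {N0 NE leP} => /=; nra.
apply: gen_clique_le.
apply: le_trans (lerD (ler_wpM2l _ (leP _)) (ler_sum _ (fun y _ => leP _))) _.
  by case: (j == gate).
have [bb|bb] := eqVneq b' b; rewrite /=; last first.
  rewrite (negbTE bb) big_split /= sum_neq_gate sum_neq_const subr0.
  by case: (j == gate) => /=; nra.
subst b'; rewrite eqxx big_split /= sum_neq_gate.
under eq_bigr do rewrite mulrBr.
rewrite big_split /= sum_neq_const sumrN -mulr_sumr.
(* The current vertex is visited, so all the vertices left in the clique are among its neighbors. *)
rewrite (sum_neq j (fun k => (Some (b, k) \in S)%:R)) -NE (negbTE xS).
by case: (j == gate) => /=; nra.
Qed.
Lemma left_in_le b S : (left_in b S <= m)%N.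
Proof.
rewrite -[X in (_ <= X)%N]card_ord -sum1_card /left_in.
by apply: leq_sum => j _; exact: leq_b1.
Qed.

(** Add the potentials of both cliques: the center is visited, so while some vertex is left at least
    one of them decreases. Each starts at no more than [2 M ^ 2 + 3 M * M]. A general [f] serves
    both the cover time and the missing of a single vertex. *)
Lemma sum_iter_gen_center_le (f : Vtx -> {set Vtx} -> R) :
  (forall x S, reachable x S -> f x S <= (S != finset.set0)%:R) ->
  forall N, \sum_(0 <= t < N) iter t (gen e) f None (~: [set None])%SET <=
    10 * M ^+ 2.
Proof.
move=> f_le N; have M8 := M_ge8.
pose F x S := \sum_b potential b x S.
apply: (@le_trans _ _ (F None (~: [set None])%SET)).
  apply: (sum_iter_gen_le reachable_step _ _ N reachable_start) => x S.
    by apply: sumr_ge0 => b _; exact: potential_ge0.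
  move=> xS; rewrite gen_sum.
  apply: (@le_trans _ _ (\sum_b
      ((left_in b S != 0%N)%:R + gen e (potential b) x S))).
    rewrite big_split /= lerD2r (le_trans (f_le _ _ xS)) //.
    have [->|/set0Pn[y yS]] := eqVneq S finset.set0; first by rewrite sumr_ge0.
    case: y yS => [[b j]|] yS; last by case: xS => _ /negP.
    rewrite (bigD1 b) //= -[X in X <= _]addr0 lerD ?sumr_ge0 //.
    rewrite (_ : left_in b S != 0%N) // /left_in -lt0n (bigD1 j) //= yS.
    by [].
  by apply: ler_sum => b _; exact: potential_drift.
have pot b : potential b None (~: [set None])%SET <= 5 * M ^+ 2.
  rewrite /potential; case: ifP => _; first by nra.
  have : (left_in b (~: [set None])%SET)%:R <= M by rewrite ler_nat left_in_le.
  by move: (left_in _ _)%:R => /= N'; nra.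
by rewrite /F big_bool /=; have := pot true; have := pot false; lra.
Qed.

(** * Upper bound on the probability of missing a vertex *)

(** A walk in the clique of the target hits it at each step with probability at
    least [1 - decay]; in [miss_bound] the term [1 / M] ([2 / M] at the gate)
    dominates the probability of leaving the clique before that. *)
Definition decay : R := 1 - M^-1.

Definition miss_bound (b : bool) (j0 : 'I_m) (t : nat)
    (x : Vtx) (S : {set Vtx}) : R :=
  if Some (b, j0) \in S then
    match x with
    | Some (b', j) => if b' == b then
        Num.min 1 (decay ^+ t + (if j == gate then 2 else 1) / M) else 1
    | None => 1
    end
  else 0.

Lemma decay_ge0 : 0 <= decay.
Proof.
by have M8 := M_ge8; rewrite /decay subr_ge0 invf_le1; [lra|rewrite (lt_le_trans _ M8)].
Qed.

Lemma miss_bound_le1 b j0 t x S : miss_bound b j0 t x S <= 1.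
Proof.
rewrite /miss_bound; case: ifP => _; last exact: ler01.
case: x => [[b' j]|] //; case: ifP => _ //.
by rewrite ge_min lexx.
Qed.

Lemma miss_bound_clique_le b j0 t j S :
  miss_bound b j0 t (Some (b, j)) (S :\ Some (b, j)) <=
  if j == j0 then 0 else decay ^+ t + M^-1 + (j == gate)%:R / M.
Proof.
have M8 := M_ge8.
have nonneg : 0 <= decay ^+ t + M^-1 + (j == gate)%:R / M.
  by rewrite !addr_ge0 ?exprn_ge0 ?decay_ge0 ?mulr_ge0 ?invr_ge0 ?ler0n.
rewrite /miss_bound !inE; have [->|jj0] := eqVneq j j0; first by rewrite !eqxx.
rewrite eqxx; case: ifP => _ //=; rewrite ge_min -addrA lerD2l; apply/orP; right.
by case: (j == gate) => /=; lra.
Qed.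

(** Outside the clique of the target only the trivial bound 1 is claimed. Inside it, the unvisited
    target is a neighbor and contributes 0, and the center, reached only from the gate, contributes
    at most 1, which the extra [1 / M] there absorbs. *)
Lemma miss_bound_step b j0 t x S : reachable x S ->
  gen e (miss_bound b j0 t) x S <= miss_bound b j0 t.+1 x S.
Proof.
have M8 := M_ge8.
move=> [xS _]; rewrite {2}/miss_bound; case: ifPn => yS; last first.
  rewrite genE big1 ?mulr0 // => y _.
  by rewrite /miss_bound !inE (negbTE yS) andbF.
case: x xS => [[b' j]|] xS; last by apply: gen_le1; exact: miss_bound_le1.
have [bb|_] := eqVneq b' b; last by apply: gen_le1; exact: miss_bound_le1.
subst b'; rewrite le_min gen_le1 /=; last exact: miss_bound_le1.
have jj0 : j0 != j by apply: contraNneq xS => <-.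
apply: gen_clique_le.
apply: le_trans (lerD (ler_wpM2l _ (miss_bound_le1 _ _ _ _ _))
  (ler_sum _ (fun y _ => miss_bound_clique_le _ _ _ _ _))) _.
  by rewrite ler0n.
rewrite (bigD1 j0) //= eqxx add0r.
rewrite (eq_bigr (fun k => decay ^+ t + M^-1 + (k == gate)%:R / M)); last first.
  by move=> k /andP[_ /negbTE ->].
set c := decay ^+ t + M^-1.
have c0 : 0 <= c by rewrite addr_ge0 ?exprn_ge0 ?decay_ge0 ?invr_ge0.
have -> : \sum_(k | (k != j) && (k != j0)) (c + (k == gate)%:R / M) =
    (M - 2) * c + ((j != gate)%:R - (j0 == gate)%:R) / M.
  have := sum_neq_gate j (c + 1 / M) c.
  rewrite (bigD1 j0) //= => H.
  have {}H : \sum_(k | (k != j) && (k != j0)) (c + (k == gate)%:R / M) =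
      (M - 1) * c + (j != gate)%:R * (c + 1 / M - c) -
      (if j0 == gate then c + 1 / M else c).
    rewrite -H [RHS]addrAC subrr add0r; apply: eq_bigr => k _.
    by case: ifP => _ //; rewrite mul0r addr0.
  rewrite H; case: ifP => _ /=; by ring.
have MV : M * M^-1 = 1 by rewrite divff // gt_eqF //; lra.
have dM : M * decay = M - 1 by rewrite /decay mulrBr MV mulr1.
rewrite exprS {}/c in c0 *.
have : 0 <= decay ^+ t by rewrite exprn_ge0 ?decay_ge0.
have : 0 < M^-1 by rewrite invr_gt0; lra.
have dE : decay = 1 - M^-1 by [].
move: (decay ^+ t) dM dE c0 MV M8; move: decay => D; move: (M^-1) => Mi; move: M => MM.
have [jg|jg] := eqVneq j gate.
  rewrite -jg (negbTE jj0) /= => D' dM dE c0 MV M8 Mi0 D'0.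
  have -> : (1 + (MM - 1)) * (D * D' + 2 * Mi) =
      (MM * D) * D' + 2 * (MM * Mi) by ring.
  have -> : 1 * 1 + ((MM - 2) * (D' + Mi) + (0 - 0) * Mi) =
      1 + (MM - 2) * D' + MM * Mi - 2 * Mi by ring.
  rewrite dM MV; nra.
move=> D' dM dE c0 MV M8 Mi0 D'0 /=.
have -> : (0 + (MM - 1)) * (D * D' + 1 * Mi) =
    (MM * D) * D' - D * D' + MM * Mi - Mi by ring.
rewrite dM MV dE.
have -> : 0 * 1 + ((MM - 2) * (D' + Mi) + (1 - (j0 == gate)%:R) * Mi) =
  (MM - 2) * D' + MM * Mi - Mi - (j0 == gate)%:R * Mi by ring.
rewrite MV; have : 0 <= (j0 == gate)%:R * Mi by rewrite mulr_ge0 // ltW.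
nra.
Qed.

(** Bernoulli's inequality for [decay^-1 = 1 + (M - 1)^-1]: its [m]-th power is at least
    [1 + M / (M - 1)], which exceeds 2. *)
Lemma decay_le_half t : (m <= t)%N -> decay ^+ t <= 2^-1.
Proof.
have M8 := M_ge8 => mt.
apply: (@le_trans _ _ (decay ^+ m)).
  by apply: ler_wiXn2l => //; rewrite ?decay_ge0 // /decay gerBl invr_ge0.
have bern (N : nat) : (1 + (M - 1)^-1) ^+ N >= 1 + N%:R * (M - 1)^-1.
  elim: N => [|N IH]; first by rewrite mul0r addr0 expr0.
  have p0 : 0 <= (M - 1)^-1 by rewrite invr_ge0; lra.
  have q0 : 0 <= N%:R * (M - 1)^-1 by rewrite mulr_ge0.
  have aux (p q z : R) : 0 <= p -> 0 <= q -> 1 + q <= z ->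
      1 + (q + p) <= (1 + p) * z by nra.
  by rewrite exprS -natr1 mulrDl mul1r; exact: aux.
have dinv : decay = (1 + (M - 1)^-1)^-1.
  by rewrite /decay; field; rewrite !gt_eqF //; lra.
rewrite dinv exprVn lef_pV2 ?posrE ?ltr0n //; last first.
  by rewrite exprn_gt0 // addr_gt0 // invr_gt0; lra.
apply: le_trans (bern m).
have -> : 1 + M * (M - 1)^-1 = 2 + (M - 1)^-1.
  by field; rewrite gt_eqF //; lra.
by rewrite lerDl invr_ge0; lra.
Qed.

(** The first step leads with probability [1 / 2] to the gate of the target's clique, where at least
    [m] steps remain and the miss probability is at most [1 / 2 + 2 / M <= 3 / 4]. With the bound 1
    for the other gate, the average is [7 / 8]. *)
Lemma miss_prob_le v t : (m < t)%N ->
  iter t (gen e) (fun _ S => (v \in S)%:R : R) None (~: [set None])%SET <= 7 / 8.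
Proof.
have M8 := M_ge8.
case: v => [[b j0]|]; last first.
  move=> _; apply: (@le_trans _ _ 0); last lra.
  apply: (iter_gen_le reachable_step (G := fun _ _ _ => 0));
    last exact: reachable_start.
    by move=> x S [_ /negbTE ->].
  by move=> s x S _; rewrite genE big1 ?mulr0.
case: t => // t; rewrite ltnS => mt; rewrite iterS gen_center.
pose f := fun (_ : Vtx) (S : {set Vtx}) => (Some (b, j0) \in S)%:R : R.
have miss x S : reachable x S -> iter t (gen e) f x S <= miss_bound b j0 t x S.
  apply: (iter_gen_le reachable_step) => [{}x {}S _|s {}x {}S];
    last exact: miss_bound_step.
  rewrite /f /miss_bound; case: ifP => // _.
  case: x => [[b' j]|] //; case: ifP => _ //.
  by rewrite le_min lexx expr0 lerDl mulr_ge0 ?invr_ge0 //; case: ifP.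
rewrite -/f.
have inv1 y := reachable_step y reachable_start.
have b1 y : iter t (gen e) f y (~: [set None] :\ y)%SET <= 1.
  exact: le_trans (miss _ _ (inv1 y)) (miss_bound_le1 _ _ _ _ _).
have b2 :
    iter t (gen e) f (Some (b, gate)) (~: [set None] :\ Some (b, gate))%SET <= 3 / 4.
  apply: le_trans (miss _ _ (inv1 _)) _.
  apply: le_trans (miss_bound_clique_le _ _ _ _ _) _.
  have := decay_le_half mt.
  have : M^-1 <= 8^-1 by rewrite lef_pV2 ?posrE //; lra.
  by case: ifP => _ /=; lra.
have := b1 (Some (~~ b, gate)); have := b2.
by case: (b) => /= ; lra.
Qed.

(** * Lower bound on the probability of leaving a clique unvisited *)

(** A lower bound on the probability that a walk in clique [b] has not entered
    the other clique: it sits at the gate about once in [M] steps and then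
    leaves with probability [1 / M]. *)
Definition far_bound (b : bool) (t : nat) (x : Vtx) (S : {set Vtx}) : R :=
  if Some (~~ b, gate) \in S then
    match x with
    | Some (b', j) => if b' == b then
        Num.max 0 (1 - (j == gate)%:R / M - 2 * t%:R / M ^+ 2) else 0
    | None => 0
    end
  else 0.

Lemma far_bound_ge0 b t x S : 0 <= far_bound b t x S.
Proof.
rewrite /far_bound; case: ifP => // _.
by case: x => [[b' j]|] //; case: ifP => _ //; rewrite le_max lexx.
Qed.

(** The center is counted as 0. At the gate the loss [1 / M] already accounts for leaving; elsewhere
    the gate is hit with probability [1 / (M - 1)], at an average loss of
    [1 / (M * (M - 1)) <= 2 / M ^ 2]. *)
Lemma far_bound_step b t x S : far_bound b t.+1 x S <= gen e (far_bound b t) x S.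
Proof.
have M8 := M_ge8.
rewrite {1}/far_bound; case: ifPn => yS; last exact/gen_ge0/far_bound_ge0.
case: x => [[b' j]|]; last exact/gen_ge0/far_bound_ge0.
have [bb|_] := eqVneq b' b; last exact/gen_ge0/far_bound_ge0.
subst b'; rewrite ge_max gen_ge0 /=; last exact: far_bound_ge0.
apply: gen_clique_ge.
have fb k : 1 - 2 * t%:R / M ^+ 2 - (k == gate)%:R / M <=
    far_bound b t (Some (b, k)) (S :\ Some (b, k)).
  have ne : (Some (~~ b, gate) == Some (b, k) :> Vtx) = false.
    by apply/negbTE/eqP => -[]; case: b {yS}.
  by rewrite /far_bound !inE yS ne /= eqxx le_max addrAC lexx orbT.
apply: le_trans (lerD (mulr_ge0 (ler0n _ _) (far_bound_ge0 _ _ _ _))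
  (ler_sum _ (fun k _ => fb k))).
rewrite add0r.
set c := 1 - 2 * t%:R / M ^+ 2.
rewrite (eq_bigr (fun k => if k == gate then c - 1 / M else c)); last first.
  by move=> k _; case: ifP => _ //; rewrite mul0r subr0.
rewrite sum_neq_gate -[t.+1%:R]natr1.
have -> : 1 - (j == gate)%:R / M - 2 * (t%:R + 1) / M ^+ 2 =
    c - (j == gate)%:R / M - 2 / M ^+ 2.
  by rewrite /c; ring.
have : c <= 1 by rewrite /c gerBl !mulr_ge0 ?invr_ge0 ?sqr_ge0 ?ler0n.
have -> : M ^- 2 = M^-1 * M^-1 by rewrite expr2 invfM.
have MV : M * M^-1 = 1 by rewrite divff // gt_eqF //; lra.
have : 0 < M^-1 by rewrite invr_gt0; lra.
clearbody c; move: M8 MV; move: (M^-1) => Mi; move: M => MM M8 MV Mi0 c1.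
case: (j == gate) => /=.
  have -> : (1 + (MM - 1)) * (c - 1 * Mi - 2 * (Mi * Mi)) =
      MM * c - MM * Mi - 2 * (MM * Mi) * Mi by ring.
  rewrite MV; nra.
have -> : (0 + (MM - 1)) * (c - 0 * Mi - 2 * (Mi * Mi)) =
  (MM - 1) * c - 2 * (MM * Mi) * Mi + 2 * Mi * Mi by ring.
rewrite MV.
have : Mi * 8 <= 1 by nra.
nra.
Qed.

(** After the first step the walk is at one gate and the other is unvisited; [far_bound] is then at
    least [1 - 1 / 8 - 1 / 4]. *)
Lemma uncovered_prob_ge t : (8 * t <= m ^ 2)%N ->
  1 / 2 <= iter t.+1 (gen e) (fun _ S => (S != finset.set0)%:R : R)
    None (~: [set None])%SET.
Proof.
have M8 := M_ge8 => tm.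
rewrite iterS gen_center.
pose f := fun (_ : Vtx) (S : {set Vtx}) => (S != finset.set0)%:R : R; rewrite -/f.
have far b x S : reachable x S -> far_bound b t x S <= iter t (gen e) f x S.
  apply: (iter_gen_ge reachable_step) => [{}x {}S _|s {}x {}S _];
    last exact: far_bound_step.
  rewrite /f /far_bound; case: ifP => // yS.
  have -> : S != finset.set0 by apply/set0Pn; exists (Some (~~ b, gate)).
  case: x => [[b' j]|] //; case: ifP => _ //.
  rewrite ge_max ler01 /= mulr0 mul0r subr0 gerBl mulr_ge0 ?invr_ge0 //.
have half b :
    1 / 2 <= iter t (gen e) f (Some (b, gate)) (~: [set None] :\ Some (b, gate))%SET.
  apply: le_trans (far b _ _ (reachable_step _ reachable_start)).
  have ne : (Some (~~ b, gate) == Some (b, gate) :> Vtx) = false.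
    by apply/negbTE/eqP => -[]; case: b.
  rewrite /far_bound !inE ne /= eqxx le_max; apply/orP; right.
  have : M^-1 <= 8^-1 by rewrite lef_pV2 ?posrE //; lra.
  have : 2 * t%:R / M ^+ 2 <= 1 / 4.
    rewrite ler_pdivrMr ?exprn_gt0; try lra.
    by move: tm; rewrite -(ler_nat R) natrM natrX; lra.
  lra.
by have := half false; have := half true; lra.
Qed.

End Barbell.

(** * From the transition operator to expected cover times *)

Section ExpectedCoverTime.
Context (R : realType) (V : finType) (e : rel V) (i : V).

Lemma expected_cover_time1E (c : \bar R) :
  expected_cover_time e i 1 c ->
  c = (\sum_(0 <= t <oo) (iter t (gen e) (fun _ S => (S != finset.set0)%:R)
         i (~: [set i])%SET)%:E)%E.
Proof.
move=> [d [T [P [X [[walks _] ->]]]]].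
rewrite integral_cover_time; last by move=> j t v; case: (walks j).
apply: eq_eseriesr => t _; rewrite uncovered1E.
exact: (prob_state (walks ord0) t (fun z => z.2 != finset.set0)).
Qed.

Definition miss_prob (v : V) (t : nat) : R :=
  iter t (gen e) (fun _ S => (v \in S)%:R) i (~: [set i])%SET.

Lemma miss_prob_ge0 v t : 0 <= miss_prob v t.
Proof. exact: iter_gen_ge0. Qed.

(** Before [t0] the tail probability is bounded by 1. From then on the union bound has [k.+1]
    factors, of which [k] are bounded by [q] and one is kept to be summed over time. *)
Lemma expected_cover_time_le (k t0 : nat) (q h : R) (c : \bar R) :
  (forall v t, (t0 <= t)%N -> miss_prob v t <= q) ->
  (forall v N, \sum_(0 <= t < N) miss_prob v t <= h) ->
  expected_cover_time e i k.+1 c ->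
  (c <= (t0%:R + #|V|%:R * (q ^+ k * h))%:E)%E.
Proof.
move=> miss_q miss_h [d [T [P [X [[walks indep] ->]]]]].
have X_meas j t v : measurable [set w | X j t w = v] by case: (walks j).
rewrite integral_cover_time //.
apply: lime_le; first exact: is_cvg_nneseries.
apply: nearW => N.
apply: (@le_trans _ _ (\sum_(0 <= t < N)
    (((t < t0)%N)%:R + \sum_v q ^+ k * miss_prob v t)%:E)%E).
  apply: lee_sum => t _; case: ltnP => tt0.
    apply: (@le_trans _ _ 1%E).
      by apply: probability_le1; exact: measurable_uncovered.
    rewrite lee_fin lerDl; apply: sumr_ge0 => v _.
    rewrite mulr_ge0 ?miss_prob_ge0 ?exprn_ge0 //.
    exact: le_trans (miss_prob_ge0 v t0) (miss_q v t0 (leqnn _)).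
  apply: le_trans (uncovered_union_bound t (conj walks indep)) _.
  rewrite lee_fin add0r; apply: ler_sum => v _.
  rewrite exprSr ler_wpM2r ?miss_prob_ge0 // lerXn2r ?nnegrE ?miss_prob_ge0 //.
    exact: le_trans (miss_prob_ge0 v t) (miss_q v t tt0).
  exact: miss_q.
rewrite sumEFin lee_fin big_split /= lerD //.
  rewrite -natr_sum ler_nat.
  elim: N => [|N IH]; first by rewrite big_nil.
  rewrite big_nat_recr //=; case: ltnP => Nt0; last by rewrite addn0.
  rewrite addn1; apply: leq_trans Nt0; rewrite ltnS.
  rewrite -[X in (_ <= X)%N]muln1 -{2}[N]subn0 -sum_nat_const_nat.
  by apply: leq_sum => t _; exact: leq_b1.
rewrite exchange_big /= mulr_natl -sumr_const; apply: ler_sum => v _.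
rewrite -mulr_sumr ler_wpM2l // exprn_ge0 //.
exact: le_trans (miss_prob_ge0 v t0) (miss_q v t0 (leqnn _)).
Qed.

End ExpectedCoverTime.

(** * Cover time bounds for the barbell graph *)

Section BarbellCoverTime.
Context (R : realType) (n : nat).
Hypotheses (n_odd : odd n) (n_ge16 : (16 <= n)%N).

Let m_ge8 : (8 <= n./2)%N. Proof. exact: (half_leq n_ge16). Qed.

Let n_eq : n%:R = 2 * (n./2)%:R + 1 :> R.
Proof.
by rewrite -[in LHS](odd_double_half n) n_odd add1n -natr1 -muln2 natrM mulrC.
Qed.

Let half_ge8 : 8 <= (n./2)%:R :> R. Proof. by rewrite (ler_nat _ 8). Qed.

Lemma barbell_cover_time_ge (c : \bar R) :
  expected_cover_time (@barbell n) (barbell_center n) 1 c ->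
  ((144^-1 * n%:R ^+ 2)%:E <= c)%E.
Proof.
have M8 := half_ge8; have nE := n_eq.
move=> /expected_cover_time1E ->.
(* There are [N >= m ^ 2 / 8] terms of size at least [1 / 2], with [m = n./2]; since [n <= 3 m], the
   sum is at least [n ^ 2 / (16 * 9)]. *)
set N := (n./2 ^ 2 %/ 8).+1.
have NM : (n./2)%:R ^+ 2 <= 8 * N%:R :> R.
  by rewrite -natrX -natrM ler_nat mulnC ltnW // ltn_ceil.
have u_ge0 t : (0 <= iter t (gen (@barbell n)) (fun _ S => (S != finset.set0)%:R)
    (barbell_center n) (~: [set barbell_center n])%SET :> R).
  exact: iter_gen_ge0.
apply: le_trans (nneseries_lim_ge N.+1 _); last by move=> t _ _; rewrite lee_fin.
(* The term of time 0 is split off because the lower bound concerns times [t.+1]. *)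
rewrite sumEFin lee_fin big_nat_recl //.
apply: (@le_trans _ _ (\sum_(0 <= t < N) 1 / 2)).
  rewrite sumr_const_nat subn0 -[_ *+ N]mulr_natl nE; nra.
rewrite -[X in X <= _]add0r lerD ?(u_ge0 0%N) //.
apply: ler_sum_nat => t /andP[_ tN]; apply: uncovered_prob_ge => //.
by rewrite mulnC -leq_divRL.
Qed.

Lemma barbell_cover_time_le (c : \bar R) :
  expected_cover_time (@barbell n) (barbell_center n) 1 c ->
  (c <= (10 * n%:R ^+ 2)%:E)%E.
Proof.
have M8 := half_ge8; have nE := n_eq.
move=> /expected_cover_time1E ->.
apply: lime_le.
  apply: is_cvg_nneseries => t _ _; rewrite lee_fin.
  exact: iter_gen_ge0.
apply: nearW => N; rewrite sumEFin lee_fin.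
apply: le_trans (sum_iter_gen_center_le m_ge8 _ N) _ => //.
rewrite nE; nra.
Qed.

Lemma barbell_multi_cover_time_le (k : nat) (c : \bar R) :
  (7 / 8) ^+ k * n%:R ^+ 2 <= 1 :> R ->
  expected_cover_time (@barbell n) (barbell_center n) k.+1 c ->
  (c <= (11 * n%:R)%:E)%E.
Proof.
have M8 := half_ge8; have nE := n_eq.
move=> qk /expected_cover_time_le => /(_ n./2.+1 (7 / 8) (10 * (n./2)%:R ^+ 2)) H.
apply: le_trans (H _ _) _.
- by move=> v t; exact: miss_prob_le.
- move=> v N; apply: (sum_iter_gen_center_le m_ge8) => x S _.
  have [->|//] := eqVneq S finset.set0; last by rewrite ler_nat leq_b1.
  by rewrite inE.
rewrite lee_fin card_barbell //.
(* Each vertex contributes at most 10 after the first [m + 1] steps, so the total is at most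
   [m + 1 + 10 n <= 11 n]. *)
have : (7 / 8) ^+ k * (10 * (n./2)%:R ^+ 2) <= 10 :> R.
  apply: le_trans (_ : 10 * ((7 / 8) ^+ k * n%:R ^+ 2) <= _); last by lra.
  rewrite mulrCA ler_wpM2l // ler_wpM2l ?exprn_ge0 //.
  by rewrite lerXn2r ?nnegrE //; lra.
rewrite -natr1; move: (_ * (10 * _)) => z z10.
have : n%:R * z <= n%:R * 10 by rewrite ler_wpM2l.
lra.
Qed.

End BarbellCoverTime.

(** * The number of walks and the conclusion *)

(** The factor 12 makes [(7 / 8) ^ 12 <= 1 / 4], so that [(7 / 8) ^ (k - 1)] is at
    most [n ^ -2]. *)
Definition walk_count (n : nat) : nat := (12 * (trunc_log 2 n).+1).+1.

Lemma ln_pow2 (R : realType) (l : nat) : ln ((2 ^ l)%:R : R) = l%:R * ln 2.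
Proof. by rewrite natrX lnXn // mulr_natl. Qed.

(** With [L = trunc_log 2 n >= 1], the count [12 L + 13] is at most [25 L], and [L * ln 2 <= ln n].
    The lower bound uses [ln n <= (L + 1) * ln 2] and [ln 2 <= 1]. *)
Lemma walk_count_ln (R : realType) (n : nat) : (2 <= n)%N ->
  1 * ln (n%:R : R) <= (walk_count n)%:R <= (25 : R) / ln 2 * ln (n%:R : R).
Proof.
move=> n2; have n_gt0 : (0 < n)%N by exact: ltn_trans n2.
have /andP[lo hi] := trunc_log_bounds (isT : (1 < 2)%N) n_gt0.
have L1 : (1 <= trunc_log 2 n)%N by rewrite trunc_log_gt0.
rewrite /walk_count; move: (trunc_log 2 n) lo hi L1 => L lo hi L1.
have ln2_gt0 : 0 < ln 2 :> R by rewrite ln_gt0 // ltr1n.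
have ln2_le1 : ln 2 <= 1 :> R.
  by have := @le_ln1Dx R 1; rewrite -mulr2n; apply; lra.
have lnn_ge : L%:R * ln 2 <= ln n%:R :> R.
  by rewrite -ln_pow2 ler_ln ?posrE ?ltr0n ?expn_gt0 // ler_nat.
have lnn_le : ln n%:R <= L.+1%:R * ln 2 :> R.
  by rewrite -ln_pow2 ler_ln ?posrE ?ltr0n ?expn_gt0 // ler_nat ltnW.
have L1R : 1 <= L%:R :> R by rewrite (ler_nat _ 1).
have LS : L.+1%:R = L%:R + 1 :> R by rewrite natr1.
have -> : (12 * L.+1).+1%:R = 12 * (L%:R + 1) + 1 :> R.
  by rewrite -[LHS]natr1 natrM LS.
rewrite LS in lnn_le; apply/andP; split; first by nra.
by rewrite mulrAC ler_pdivlMr //; nra.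
Qed.

Lemma walk_count_decay (R : realType) (n : nat) : (0 < n)%N ->
  (7 / 8) ^+ (walk_count n).-1 * n%:R ^+ 2 <= 1 :> R.
Proof.
move=> n_gt0; rewrite /walk_count /=.
have /andP[_] := trunc_log_bounds (isT : (1 < 2)%N) n_gt0.
move: (trunc_log 2 n).+1 => L nL.
have q12 : (7 / 8) ^+ 12 <= 1 / 4 :> R by lra.
apply: (@le_trans _ _ ((1 / 4) ^+ L * (2 ^+ L) ^+ 2)).
  apply: ler_pM; rewrite ?exprn_ge0 //.
    by rewrite exprM lerXn2r ?nnegrE ?exprn_ge0.
  by rewrite lerXn2r ?nnegrE ?exprn_ge0 // -natrX ler_nat ltnW.
rewrite -exprM mulnC exprM -exprMn (_ : 1 / 4 * 2 ^+ 2 = 1) ?expr1n //; lra.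
Qed.

Theorem theorem7 (R : realType) :
  (exists a b : R, [/\ 0 < a, 0 < b &
     \forall n \near \oo, odd n -> (1 < n)%N ->
       forall c : \bar R,
         expected_cover_time (@barbell n) (barbell_center n) 1 c ->
         ((a * n%:R ^+ 2)%:E <= c <= (b * n%:R ^+ 2)%:E)%E])
  /\
  (exists k : nat -> nat,
     [/\ forall n, (1 <= k n)%N,
         exists a b : R, [/\ 0 < a, 0 < b &
           \forall n \near \oo, odd n -> (1 < n)%N ->
             a * ln n%:R <= (k n)%:R <= b * ln n%:R] &
         exists b : R, 0 < b /\
           \forall n \near \oo, odd n -> (1 < n)%N ->
             forall c : \bar R,
               expected_cover_time (@barbell n) (barbell_center n) (k n) c ->
               (c <= (b * n%:R)%:E)%E]).
Proof.
split.
  exists 144^-1, 10; split => //.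
  (* From 16 on, the cliques have at least 8 vertices, as the numerical estimates require. *)
  exists 16%N => // n /= n16 n_odd _ c Hc; apply/andP; split.
    exact: barbell_cover_time_ge Hc.
  exact: barbell_cover_time_le Hc.
exists walk_count; split => //.
  exists 1, (25 / ln 2); split => //.
    by rewrite divr_gt0 // ln_gt0 // ltr1n.
  by exists 2%N => // n /= n2 _ _; exact: walk_count_ln.
exists 11; split => //.
exists 16%N => // n /= n16 n_odd n1 c Hc.
apply: (barbell_multi_cover_time_le n_odd n16 _ Hc).
by apply: walk_count_decay; exact: ltn_trans n1.
Qed.
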